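(* Let $X$ be an Archimedean pervasive pre-Riesz space and $I$ an s-closed directed ideal in $X$. Then $(I^{dd})_+ \subseteq I_+$. If, in addition, the band $I^{dd}$ is directed, then $I = I^{dd}$, i.e. $I$ is a band.
   Context: An ordered vector space is a real vector space $X$ with the partial order given by a cone $X_+$ ($x\le y$ iff $y-x\in X_+$); it is Archimedean if $nx\le y$ for all $n\in\mathbb{N}$ implies $x\le 0$. For $A\subseteq X$ put $A_+:=A\cap X_+$, and $[a,b]:=\{x\in X: a\le x\le b\}$. A subset $A\subseteq X$ is directed if for all $x,y\in A$ there are $z_1,z_2\in A$ with $z_1\le x,y\le z_2$. A linear subspace $X_0$ of an ordered vector space $Y$ is order dense in $Y$ if $y=\inf\{z\in X_0: y\le z\}$ for every $y\in Y$. $X$ is a pre-Riesz space if there are a vector lattice $Y$ and a bipositive linear map $i:X\to Y$ (i.e. $x\ge0 \Leftrightarrow i(x)\ge 0$) with $i(X)$ order dense in $Y$; then $(Y,i)$ is called a vector lattice cover of $X$. $X$ is pervasive if for some (equivalently, every) vector lattice cover $(Y,i)$ and every $y\in Y_+$, $y\ne0$, there is $x\in X$ with $0<i(x)\le y$. For $M\subseteq X$ let $M^u$ be the set of all upper bounds of $M$ in $X$. Elements $x,y\in X$ are disjoint, $x\perp y$, if $\{x+y,-x-y\}^u=\{x-y,-x+y\}^u$. The disjoint complement of $A\subseteq X$ is $A^{d}:=\{x\in X: x\perp a \text{ for all } a\in A\}$ and $A^{dd}:=(A^d)^d$. A linear subspace $B$ is a band if $B^{dd}=B$ (disjoint complements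 are always bands). A set $M\subseteq X$ is solid if for all $x\in X$, $y\in M$, $\{x,-x\}^u\supseteq\{y,-y\}^u$ implies $x\in M$; an ideal is a solid linear subspace. An ideal $I$ is s-closed (supremum closed) if for every $z\in X_+$ the relation $z=\sup(I\cap[0,z])$ (meaning that the supremum exists in $X$ and equals $z$) implies $z\in I$. *)

(* Defs.v *)
From HB Require Import structures.
From mathcomp Require Import all_boot all_order all_algebra.
From mathcomp Require Import mathcomp_extra boolp classical_sets set_interval reals.

Set Implicit Arguments.
Unset Strict Implicit.
Unset Printing Implicit Defensive.

Import Order.TTheory GRing.Theory Num.Theory.

Local Open Scope classical_set_scope.
Local Open Scope ring_scope.

(* The positive cone is X_+ = {x | 0 <= x}. Its closure under addition follows
   from [subv_ge0] and transitivity, and X_+ `&` - X_+ = {0} from antisymmetry. *)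
HB.mixin Record isOrderedVect (R : numDomainType) X
    of Num.POrderedZmodule X & GRing.Lmodule R X := {
  subv_ge0 : forall x y : X, (0 <= y - x) = (x <= y);
  scalev_ge0 : forall (a : R) (x : X), 0 <= a -> 0 <= x -> 0 <= a *: x
}.

#[short(type="orderedVectType")]
HB.structure Definition OrderedVect (R : numDomainType) :=
  { X of isOrderedVect R X & Num.POrderedZmodule X & GRing.Lmodule R X }.

Definition vector_lattice (R : numDomainType) (Y : orderedVectType R) : Prop :=
  forall x y : Y, (exists s, supremums [set x; y] s) /\
                  (exists t, infimums [set x; y] t).

(* Here n = 0 is included, so that y >= 0 is part of the premise; when X is
   directed, as every pre-Riesz space is, this agrees with taking n >= 1. *)
Definition archimedean_space (R : numDomainType) (X : orderedVectType R) : Prop :=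
  forall x y : X, (forall n : nat, x *+ n <= y) -> x <= 0.

Definition positives (R : numDomainType) (X : orderedVectType R) (A : set X) : set X :=
  A `&` [set x | 0 <= x].

Definition directed (R : numDomainType) (X : orderedVectType R) (A : set X) : Prop :=
  forall x y : X, A x -> A y ->
    exists z1 z2 : X, [/\ A z1, A z2, z1 <= x /\ z1 <= y & x <= z2 /\ y <= z2].

Definition linear_subspace (R : numDomainType) (X : orderedVectType R)
    (A : set X) : Prop :=
  A 0 /\ forall (a : R) (x y : X), A x -> A y -> A (a *: x + y).

Definition order_dense (R : numDomainType) (Y : orderedVectType R)
    (X0 : set Y) : Prop :=
  linear_subspace X0 /\
  forall y : Y, infimums [set z | X0 z /\ y <= z] y.

Definition bipositive (R : numDomainType) (X Y : orderedVectType R)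
    (i : X -> Y) : Prop :=
  forall x : X, 0 <= x <-> 0 <= i x.

Definition vector_lattice_cover (R : numDomainType) (X : orderedVectType R)
    (Y : orderedVectType R) (i : {linear X -> Y}) : Prop :=
  [/\ vector_lattice Y, bipositive i & order_dense (range i)].

Definition pre_Riesz (R : numDomainType) (X : orderedVectType R) : Prop :=
  exists (Y : orderedVectType R) (i : {linear X -> Y}),
    vector_lattice_cover i.

Definition pervasive (R : numDomainType) (X : orderedVectType R) : Prop :=
  exists (Y : orderedVectType R) (i : {linear X -> Y}),
    vector_lattice_cover i /\
    forall y : Y, 0 <= y -> y <> 0 -> exists x : X, 0 < i x /\ i x <= y.

Definition ovs_disjoint (R : numDomainType) (X : orderedVectType R) (x y : X) : Prop :=
  ubound [set x + y; - x - y] = ubound [set x - y; - x + y].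

Definition disjoint_compl (R : numDomainType) (X : orderedVectType R)
    (A : set X) : set X :=
  [set x | forall a : X, A a -> ovs_disjoint x a].

Definition band (R : numDomainType) (X : orderedVectType R) (B : set X) : Prop :=
  linear_subspace B /\ disjoint_compl (disjoint_compl B) = B.

Definition solid (R : numDomainType) (X : orderedVectType R) (M : set X) : Prop :=
  forall x y : X, M y -> ubound [set y; - y] `<=` ubound [set x; - x] -> M x.

Definition ideal (R : numDomainType) (X : orderedVectType R) (I : set X) : Prop :=
  solid I /\ linear_subspace I.

Definition s_closed (R : numDomainType) (X : orderedVectType R) (I : set X) : Prop :=
  forall z : X, 0 <= z -> supremums (I `&` `[0, z]) z -> I z.

(* Main.v *)
(** For 0 <= z in I^dd it suffices to show that z is the supremum of
   I `&` [0, z].  If u is an upper bound of this set with ~ z <= u, then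
   pervasiveness yields 0 < x below (z - u)^+.  Since x <= z, x is not in I^d,
   hence some v in I satisfies 0 < v <= x.  Now n v in [0, z] implies n v <= u,
   so (z - u)^+ <= z - n v and (n + 1) v <= z; thus n v <= z for all n,
   which contradicts the Archimedean property. *)

Require Import Defs.
From mathcomp Require Import all_boot all_order all_algebra.
From mathcomp Require Import boolp classical_sets reals.

Local Open Scope classical_set_scope.
Local Open Scope ring_scope.

Import Order.TTheory GRing.Theory Num.Theory.

Section OrderedVect.
Context {R : numDomainType} {X : orderedVectType R}.
Implicit Types (x y z t a b : X) (A I : set X).

Lemma levD x y z t : x <= y -> z <= t -> x + z <= y + t.
Proof.
move=> xy zt; apply: (@le_trans _ _ (y + z)).
  by rewrite -subv_ge0 opprD addrACA subrr addr0 subv_ge0.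
by rewrite -subv_ge0 opprD addrACA subrr add0r subv_ge0.
Qed.

Lemma levBrDr x y z : (x <= y - z) = (x + z <= y).
Proof. by rewrite -[LHS]subv_ge0 -[RHS]subv_ge0 opprD addrA addrAC. Qed.

Lemma levBlDr x y z : (x - y <= z) = (x <= z + y).
Proof. by rewrite -[in RHS](opprK y) levBrDr. Qed.

Lemma levN2 x y : (- x <= - y) = (y <= x).
Proof. by rewrite -[LHS]subv_ge0 opprK addrC subv_ge0. Qed.

Lemma subv_le0 x y : (x - y <= 0) = (x <= y).
Proof. by rewrite levBlDr add0r. Qed.

Lemma oppv_le0 x : (- x <= 0) = (0 <= x).
Proof. by rewrite -levN2 oppr0 opprK. Qed.

Lemma oppv_ge0 x : (0 <= - x) = (x <= 0).
Proof. by rewrite -oppv_le0 opprK. Qed.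

Lemma ubound2P x y t : ubound [set x; y] t <-> x <= t /\ y <= t.
Proof.
split=> [h|[xt yt] _ [->|->]//].
by split; apply: h; [left|right].
Qed.

Lemma ovs_disjoint_sym x y : ovs_disjoint x y -> ovs_disjoint y x.
Proof.
rewrite /ovs_disjoint => xy.
by rewrite addrC [- y - x]addrC xy setUC [- x + y]addrC [x - y]addrC.
Qed.

Lemma ovs_disjointNl x y : ovs_disjoint x y -> ovs_disjoint (- x) y.
Proof. by rewrite /ovs_disjoint opprK => xy; rewrite setUC -xy setUC. Qed.

(** Since [0 <= x <= z], the element [z - x] is above both [z - x] and [- z + x]; disjointness makes
    it an upper bound of [z + x] too, whence [x + x <= 0]. *)
Lemma ovs_disjoint_le_eq0 x z : 0 <= x -> x <= z -> ovs_disjoint z x -> x = 0.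
Proof.
move=> x0 xz zx.
have z0 := le_trans x0 xz.
have : ubound [set z - x; - z + x] (z - x).
  apply/ubound2P; split=> //; rewrite [- z + x]addrC.
  by apply: (@le_trans _ _ 0); rewrite ?subv_le0 ?subv_ge0.
rewrite -zx => /ubound2P[+ _].
rewrite levBrDr -addrA addrC -levBrDr subrr => xx0.
apply/eqP; rewrite eq_le x0 andbT; apply: le_trans xx0.
by rewrite -{1}[x]addr0 levD.
Qed.

Lemma ideal_le I x y : ideal I -> I y -> 0 <= x -> x <= y -> I x.
Proof.
move=> [sI _] Iy x0 xy; apply: (sI x y Iy) => t /ubound2P[yt _].
have xt := le_trans xy yt; apply/ubound2P; split=> //.
by apply: le_trans (le_trans x0 xt); rewrite oppv_le0.
Qed.

Lemma subset_disjoint_compl2 A : A `<=` disjoint_compl (disjoint_compl A).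
Proof. by move=> x Ax a /(_ x Ax)/ovs_disjoint_sym. Qed.

Lemma disjoint_complN A x : disjoint_compl A x -> disjoint_compl A (- x).
Proof. by move=> Ax a /Ax/ovs_disjointNl. Qed.

Lemma linear_subspaceN I x : linear_subspace I -> I x -> I (- x).
Proof. by move=> [I0 lI] Ix; rewrite -scaleN1r -[_ *: _]addr0; apply: lI. Qed.

Lemma linear_subspaceD I x y : linear_subspace I -> I x -> I y -> I (x + y).
Proof. by move=> [_ lI] Ix Iy; rewrite -[x]scale1r; apply: lI. Qed.

End OrderedVect.

(* The elements [q] are the upper bounds in X of the positive part of [p],
   which exists only in a vector lattice cover. *)
Lemma pervasive_minorant (R : numDomainType) (X : orderedVectType R) (p : X) :
  pervasive X -> ~ p <= 0 ->
  exists2 v : X, 0 < v & forall q : X, 0 <= q -> p <= q -> v <= q.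
Proof.
move=> [Y [i [[latY bip _] perv]]] pN0.
have ile x y : (x <= y) <-> (i x <= i y).
  by rewrite -subv_ge0 -[i x <= _]subv_ge0 -raddfB; exact: bip.
have [[w [/ubound2P[pw w0] wmin]] _] := latY (i p) 0.
have wN0 : w <> 0 by move=> w_eq0; apply/pN0/ile; rewrite raddf0 -w_eq0.
have [v [v_gt0 vw]] := perv w w0 wN0.
exists v.
  rewrite lt_neqAle; apply/andP; split; last exact/bip/ltW.
  by apply: contraTN v_gt0 => /eqP <-; rewrite raddf0 ltxx.
move=> q q0 pq; apply/ile/(le_trans vw)/wmin/ubound2P.
by split; [exact/ile|exact/bip].
Qed.

Section Pervasive.
Context {R : numFieldType} {X : orderedVectType R}.
Implicit Types (x v z : X) (I : set X).

(** In [ideal_minorant] the minorant is bounded only by the doubles [b + b] and [x + x]; halving it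
    removes the factor 2. *)
Lemma half_le v x : v <= x + x -> 2^-1 *: v <= x.
Proof.
rewrite -subv_ge0 => /(scalev_ge0 (2^-1 : R)).
rewrite invr_ge0 ler0n => /(_ isT).
rewrite scalerBr -mulr2n -scaler_nat scalerA mulVf ?pnatr_eq0// scale1r.
by rewrite subv_ge0.
Qed.

Lemma half_gt0 v : 0 < v -> 0 < 2^-1 *: v.
Proof.
move=> v0; rewrite lt_neqAle scalev_ge0 ?invr_ge0 ?ler0n ?(ltW v0)// andbT.
by rewrite eq_sym scaler_eq0 invr_eq0 pnatr_eq0 (gt_eqF v0).
Qed.

(** If disjointness fails, then for some [a] in [I] an upper bound [t] of [x + a] and [- x - a] is
    not above [x - a]. In a cover, the positive part of [x - a - t] is then nonzero and lies below
    both [x + x] and [b + b], where [b] in [I] is above [0] and [- a]. Half of a minorant is below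
    [x] and, by solidity, in [I]. *)
Lemma ideal_minorant I x : pervasive X -> ideal I -> directed I -> 0 <= x ->
  ~ disjoint_compl I x -> exists v, [/\ I v, 0 < v & v <= x].
Proof.
move=> pervX idI dirI x0; apply: contra_notP => Nv.
have lI : linear_subspace I by case: idI.
(* Replacing [a] by [- a] exchanges the two sets of upper bounds, so one inclusion suffices. *)
suff key a :
    I a -> ubound [set x + a; - x - a] `<=` ubound [set x - a; - x + a].
  move=> a Ia; rewrite /ovs_disjoint; apply/seteqP; split; first exact: key.
  by have := key (- a) (linear_subspaceN _ _ lI Ia); rewrite opprK.
move=> Ia t /ubound2P[xat Nxat]; apply/ubound2P; split; last first.
  by apply: le_trans xat; apply: levD => //; apply: (le_trans _ x0); rewrite oppv_le0.
apply: contra_notP Nv => /negP Nt.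
have [_ [b [_ Ib _ [b0 Nab]]]] := dirI 0 (- a) lI.1 (linear_subspaceN _ _ lI Ia).
have [|v v0 vmin] := pervasive_minorant _ _ (x - a - t) pervX.
  by rewrite subv_le0; exact/negP.
have h0 := half_gt0 _ v0.
(* The two bounds on [t] serve in turn: [x + a <= t] gives [x - a - t <= - a - a <= b + b], and
   [- x - a <= t] gives [x - a - t <= x + x]. *)
have hb : 2^-1 *: v <= b.
  apply/half_le/vmin; first by rewrite -[0]addr0 levD.
  apply: (@le_trans _ _ (- a - a)); last exact: levD.
  by rewrite levBlDr -addrA [x - a]addrC levD// [- a + t]addrC levBrDr.
have hx : 2^-1 *: v <= x.
  apply/half_le/vmin; first by rewrite -[0]addr0 levD.
  rewrite levBlDr -addrA levD// addrC -levBlDr addrC.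
  exact: Nxat.
by exists (2^-1 *: v); split=> //; apply: ideal_le hb => //; exact: ltW.
Qed.

Lemma sup_ideal_bicompl I z :
  archimedean_space X -> pervasive X -> ideal I -> directed I ->
  0 <= z -> disjoint_compl (disjoint_compl I) z ->
  supremums (I `&` `[0, z]) z.
Proof.
move=> arch pervX idI dirI z0 zdd; split=> [y [_ /=]|u uub].
  by rewrite in_itv /= => /andP[].
have lI : linear_subspace I by case: idI.
(* Testing [u] on the element [0] gives [z - u <= z], which later puts the minorant [x] below
   [z]. *)
have u0 : 0 <= u by apply: uub; split; [exact: lI.1|rewrite /= in_itv /= lexx].
apply: contrapT => Nzu.
have [|x x0 xmin] := pervasive_minorant _ _ (z - u) pervX.
  by rewrite subv_le0.
have xz : x <= z by apply: xmin; rewrite // levBlDr -{1}[z]addr0 levD.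
have [|v [Iv v0 vx]] := ideal_minorant I x pervX idI dirI (ltW x0).
  move=> /zdd zx; have := x0.
  by rewrite (ovs_disjoint_le_eq0 x z (ltW x0) xz zx) ltxx.
(* Membership in [I] is carried through the induction because [u] bounds [v *+ n] only once it is
   known to lie in [I] and in [[0, z]]. *)
suff vz n : I (v *+ n) /\ 0 <= v *+ n <= z.
  have : v <= 0 by apply: (arch v z) => n; have [_ /andP[]] := vz n.
  by rewrite (lt_geF v0).
elim: n => [|n [In /andP[n0 nz]]].
  by rewrite mulr0n lexx z0; split=> //; exact: lI.1.
rewrite mulrS; split; first exact: linear_subspaceD.
apply/andP; split; first by rewrite -[0]addr0 levD// ltW.
rewrite -levBrDr; apply/(le_trans vx)/xmin; first by rewrite subv_ge0.
by rewrite levD// levN2; apply: uub; split=> //; rewrite /= in_itv /= n0.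
Qed.

End Pervasive.

Theorem theorem10 (R : realType) (X : orderedVectType R)
    (harch : archimedean_space X) (hpre : pre_Riesz X) (hperv : pervasive X)
    (I : set X) (hI : ideal I) (hdir : directed I) (hs : s_closed I) :
  positives (disjoint_compl (disjoint_compl I)) `<=` positives I /\
  (directed (disjoint_compl (disjoint_compl I)) ->
     I = disjoint_compl (disjoint_compl I) /\ band I).
Proof.
have lI : linear_subspace I by case: hI.
have pos : positives (disjoint_compl (disjoint_compl I)) `<=` positives I.
  by move=> z [zdd z0]; split=> //; apply: hs => //; exact: sup_ideal_bicompl.
split=> // dirdd.
suff eqI : I = disjoint_compl (disjoint_compl I) by split=> //; split.
have Isub := subset_disjoint_compl2 I.
apply/seteqP; split=> // x xdd.
(* Taking [0] as the second element makes [z2] and [- z1] positive, so the first part places both in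
   [I]. *)
have [z1 [z2 [z1dd z2dd [z10 z1x] [z20 xz2]]]] := dirdd 0 x (Isub _ lI.1) xdd.
have [Iz2 _] := pos z2 (conj z2dd z20).
have Nz1_ge0 : 0 <= - z1 by rewrite oppv_ge0.
have [INz1 _] := pos (- z1) (conj (disjoint_complN _ _ z1dd) Nz1_ge0).
(* By solidity it is enough that [z2 - z1] dominates [x] and [- x]: one summand does so, and the
   other is positive. *)
apply: hI.1 (linear_subspaceD _ _ _ lI Iz2 INz1) _ => t /ubound2P[zt _].
apply/ubound2P; split; apply: le_trans zt.
  by rewrite -[x]addr0 levD.
by rewrite -[- x]add0r levD// levN2.
Qed.
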